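(* Let $W$ be a finite Coxeter group with root system $R$ and reflection representation $\mathfrak h$. (1) Any $W$-module homomorphism $\mu\in\mathrm{Hom}_W(\mathfrak h,V_W)$ is given by a formula $$\mu(x)=\sum_{\alpha\in R}c_\alpha(x,\alpha)[\alpha],$$ where $\alpha\mapsto c_\alpha$ is a $W$-invariant scalar function on the root system $R$. (2) The support of $\mu(\mathfrak h)$ is $\{\alpha\in R\mid c_\alpha\neq0\}$. (3) $\mu$ is injective if and only if $\mathrm{supp}\,\mu(\mathfrak h)$ spans $\mathfrak h$.
   Context: Coxeter group: $W$ is a finite Coxeter group generated by $s_1,\dots,s_r$ subject to $(s_is_j)^{m_{ij}}=1$, with integers $m_{ii}=1$, $m_{ij}=m_{ji}\ge 2$ for $i\neq j$. $\mathfrak{h}$ is the complex vector space with basis $\alpha_1,\dots,\alpha_r$ and non-degenerate symmetric bilinear form $(\alpha_i,\alpha_j)=-\cos(\pi/m_{ij})$; $W$ acts on $\mathfrak h$ by letting $s_i$ act as $h\mapsto h-2(h,\alpha_i)\alpha_i$ (the reflection representation). $R=\{w(\alpha_i): w\in W, 1\le i\le r\}$ is the root system; $R^+$ is the set of positive roots, $R=R^+\sqcup -R^+$. $V_W$ is the complex vector space spanned by symbols $[\alpha]$, $\alpha\in R$, subject to the relations $[-\alpha]=-[\alpha]$ (so $\dim V_W=|R^+|$), with $W$-action $w[\alpha]=[w\alpha]$. Support: let $\langle\cdot,\cdot\rangle$ be the bilinear form on $V_W$ with $\langle[\alpha],[\beta]\rangle=\delta_{\alpha,\beta}$ for $\alpha,\beta\in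 R^+$. For a linear subspace $U\subset V_W$, $\mathrm{supp}\,U=\{\alpha\in R:\langle u,[\alpha]\rangle\neq0\text{ for some }u\in U\}$. *)

(* Defs.v *)
From HB Require Import structures.
From mathcomp Require Import all_boot all_order all_fingroup all_algebra all_character.
From mathcomp Require Import complex.
From mathcomp Require Import boolp classical_sets reals trigo.

Set Implicit Arguments.
Unset Strict Implicit.
Unset Printing Implicit Defensive.
Import Order.TTheory GRing.Theory Num.Theory.
Local Open Scope ring_scope.

Section QuotientSpace.
Variables (K : fieldType) (vT : vectType K) (U : {vspace vT}).

Definition quotv : Type := Quotient.quot (pred_of_vspace U).
HB.instance Definition _ := GRing.Zmodule.on quotv.

Definition quotv_pi (x : vT) : quotv := \pi_(Quotient.quot (pred_of_vspace U))%qT x.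
Definition quotv_repr (u : quotv) : vT :=
  generic_quotient.repr (u : Quotient.quot (pred_of_vspace U)).
Definition quotv_scale (a : K) (u : quotv) : quotv :=
  quotv_pi (a *: quotv_repr u).

Lemma quotv_piE (x y : vT) : quotv_pi x = quotv_pi y <-> x - y \in U.
Proof.
have e : (x - y \in U) = (quotv_pi x == quotv_pi y).
  exact: (@Quotient.idealrBE vT (pred_of_vspace U)).
by rewrite e; split => [/eqP|/eqP].
Qed.

Lemma quotv_reprK (u : quotv) : quotv_pi (quotv_repr u) = u.
Proof. exact: reprK. Qed.

Lemma quotv_piD (x y : vT) : quotv_pi (x + y) = quotv_pi x + quotv_pi y.
Proof. by rewrite /quotv_pi raddfD. Qed.

Lemma quotv_scale_pi (a : K) (x : vT) :
  quotv_scale a (quotv_pi x) = quotv_pi (a *: x).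
Proof.
apply/quotv_piE; rewrite -scalerBr; apply: memvZ.
by apply/quotv_piE; rewrite quotv_reprK.
Qed.

Let scaleA a b u : quotv_scale a (quotv_scale b u) = quotv_scale (a * b) u.
Proof. by rewrite -(quotv_reprK u) !quotv_scale_pi scalerA. Qed.
Let scale1 : left_id 1 quotv_scale.
Proof. by move=> u; rewrite -(quotv_reprK u) quotv_scale_pi scale1r. Qed.
Let scaleDr : right_distributive quotv_scale +%R.
Proof.
move=> a u v; rewrite -(quotv_reprK u) -(quotv_reprK v).
by rewrite -quotv_piD !quotv_scale_pi scalerDr quotv_piD.
Qed.
Let scaleDl u : {morph quotv_scale^~ u : a b / a + b}.
Proof.
by move=> a b; rewrite -(quotv_reprK u) !quotv_scale_pi scalerDl quotv_piD.
Qed.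

HB.instance Definition _ :=
  GRing.Zmodule_isLmodule.Build K quotv scaleA scale1 scaleDr scaleDl.

Lemma quotv_pi_is_linear : linear quotv_pi.
Proof. by move=> a x y; rewrite quotv_piD -quotv_scale_pi. Qed.
HB.instance Definition _ :=
  GRing.isLinear.Build K vT quotv *:%R quotv_pi quotv_pi_is_linear.

End QuotientSpace.

Section Coxeter.

Definition coxeter_matrix r (m : 'M[nat]_r) : Prop :=
  [/\ forall i, m i i = 1%N, forall i j, m i j = m j i
    & forall i j, i != j -> (2 <= m i j)%N].

(* W is generated by the s i subject to the relations (s i * s j) ^+ m i j = 1;
   the universal property ranges over all groups, not only the finite ones. *)
Definition coxeter_presentation r (m : 'M[nat]_r) (W : finGroupType)
    (s : 'I_r -> W) : Prop :=
  [/\ <<[set s i | i : 'I_r]>>%g = [set: W],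
      forall i j, ((s i * s j) ^+ m i j = 1)%g
    & forall (H : groupType) (t : 'I_r -> H),
        (forall i j, ((t i * t j) ^+ m i j = 1)%g) ->
        exists f : {multiplicative W -> H}, forall i, f (s i) = t i].

Variables (R : realType) (r : nat).
Implicit Types (m : 'M[nat]_r) (x y : 'cV[R[i]]_r).

Definition simple_root (i : 'I_r) : 'cV[R[i]]_r := delta_mx i 0.

Definition gram m : 'M[R[i]]_r :=
  \matrix_(i, j) (- cos (pi / (m i j)%:R))%:C%C.

Definition hform m x y : R[i] := (x^T *m gram m *m y) 0 0.

Definition simple_reflection m (i : 'I_r) x : 'cV[R[i]]_r :=
  x - (2 * hform m x (simple_root i)) *: simple_root i.

(* Representations act on column vectors from the left: w sends x to rho w *m x. *)
Definition reflection_representation m (W : finGroupType) (s : 'I_r -> W)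
    (rho : mx_representation R[i] [set: W] r) : Prop :=
  forall i x, rho (s i) *m x = simple_reflection m i x.

Section Roots.
Variables (W : finGroupType) (rho : mx_representation R[i] [set: W] r).

Definition root_system : seq 'cV[R[i]]_r :=
  undup [seq rho w *m simple_root i | w <- enum W, i <- enum 'I_r].

(* On R[i], 0 <= z means that z is real and nonnegative. *)
Definition positive_roots : seq 'cV[R[i]]_r :=
  [seq a : 'cV[R[i]]_r <- root_system | [forall i, 0 <= a i 0]].

Definition root_free : Type := {ffun seq_sub root_system -> R[i]^o}.
HB.instance Definition _ := Vector.on root_free.

Definition root_symb (a : 'cV[R[i]]_r) : root_free :=
  [ffun b : seq_sub root_system => (val b == a)%:R].

Definition root_rel : {vspace root_free} :=
  <<[seq (root_symb a + root_symb (- a))%R | a <- root_system]>>%VS.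

(* The free space on the roots modulo the relations br (- a) = - br a. *)
Definition VW : Type := quotv root_rel.
HB.instance Definition _ := GRing.Lmodule.on VW.

Definition br (a : 'cV[R[i]]_r) : VW := quotv_pi root_rel (root_symb a).

Definition free_act (w : W) (f : root_free) : root_free :=
  \sum_(b : seq_sub root_system) f b *: root_symb (rho w *m val b).

(* Induced on classes; VW_act_pi shows independence of the representative. *)
Definition VW_act (w : W) (u : VW) : VW :=
  quotv_pi root_rel (free_act w (quotv_repr u)).

Lemma mem_root_system a :
  reflect (exists w i, a = rho w *m simple_root i) (a \in root_system).
Proof.
rewrite mem_undup; apply: (iffP allpairsP) => [[[w i] /= [_ _ ->]]|[w [i ->]]].
  by exists w, i.
by exists (w, i); rewrite !mem_enum.
Qed.

Lemma rho_root_system w a : (rho w *m a \in root_system) = (a \in root_system).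
Proof.
have cl v b : b \in root_system -> rho v *m b \in root_system.
  move=> /mem_root_system[v' [i ->]]; apply/mem_root_system; exists (v * v')%g, i.
  by rewrite mulmxA repr_mxM ?inE.
apply/idP/idP => [|/cl//]; move=> /(cl w^-1%g).
by rewrite mulmxA -repr_mxM ?inE// mulVg repr_mx1 mul1mx.
Qed.

Lemma root_symb_notin a : a \notin root_system -> root_symb a = 0.
Proof.
move=> aN; apply/ffunP => b; rewrite !ffunE; case: eqP => //= ba.
by rewrite -ba (valP b) in aN.
Qed.

Lemma free_act_linear w : linear (free_act w).
Proof.
move=> k f g; rewrite /free_act scaler_sumr -big_split; apply: eq_bigr => b _ /=.
by rewrite !ffunE scalerDl scalerA.
Qed.
HB.instance Definition _ w :=
  GRing.isLinear.Build R[i] root_free root_free *:%R (free_act w)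
    (free_act_linear w).

Lemma free_act_symb w a : free_act w (root_symb a) = root_symb (rho w *m a).
Proof.
have [aR|aN] := boolP (a \in root_system); last first.
  by rewrite !root_symb_notin ?rho_root_system// linear0.
rewrite /free_act (bigD1 (SeqSub aR))//= ffunE eqxx scale1r.
rewrite big1 ?addr0// => b ba; rewrite ffunE.
case: eqP => [e|_]; last by rewrite scale0r.
by case/eqP: ba; apply/val_inj.
Qed.

Lemma free_act_rel w f : f \in root_rel -> free_act w f \in root_rel.
Proof.
move=> fK; have -> : free_act w f = linfun (free_act w) f by rewrite lfunE.
suff /subvP : (linfun (free_act w) @: root_rel <= root_rel)%VS.
  by apply; exact: memv_img.
rewrite /root_rel limg_span; apply: sub_span => _ /mapP[_ /mapP[a aR ->] ->].
rewrite lfunE; apply/mapP; exists (rho w *m a); first by rewrite rho_root_system.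
rewrite -mulmxN -!free_act_symb; exact: linearD.
Qed.

Lemma VW_act_pi w f :
  VW_act w (quotv_pi root_rel f) = quotv_pi root_rel (free_act w f).
Proof.
apply/quotv_piE; rewrite -linearB; apply: free_act_rel.
by apply/quotv_piE; rewrite quotv_reprK.
Qed.

Lemma VW_act_linear w : linear (VW_act w).
Proof.
move=> k u v; rewrite -(quotv_reprK u) -(quotv_reprK v).
by rewrite -linearP !VW_act_pi !linearP.
Qed.
HB.instance Definition _ w :=
  GRing.isLinear.Build R[i] VW VW *:%R (VW_act w) (VW_act_linear w).

Lemma VW_act_br w a : VW_act w (br a) = br (rho w *m a).
Proof. by rewrite VW_act_pi free_act_symb. Qed.

Lemma br_opp a : a \in root_system -> br (- a) = - br a.
Proof.
move=> aR; rewrite -linearN; apply/quotv_piE; rewrite opprK addrC.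
by apply/memv_span/map_f.
Qed.

Definition W_hom (mu : {linear 'cV[R[i]]_r -> VW}) : Prop :=
  forall w x, mu (rho w *m x) = VW_act w (mu x).

Definition W_invariant (c : 'cV[R[i]]_r -> R[i]) : Prop :=
  forall w a, a \in root_system -> c (rho w *m a) = c a.

Definition VW_form (B : {biscalar VW}) : Prop :=
  forall a b, a \in positive_roots -> b \in positive_roots ->
    B (br a) (br b) = (a == b)%:R.

Definition supp (B : {biscalar VW}) (U : set VW) : seq 'cV[R[i]]_r :=
  [seq a <- root_system | `[< exists2 u, U u & B u (br a) != 0 >]].

End Roots.
End Coxeter.

(* Main.v *)
Require Import Defs.
From HB Require Import structures.
From mathcomp Require Import all_boot all_order all_fingroup all_algebra all_character.
From mathcomp Require Import complex.
From mathcomp Require Import boolp classical_sets reals trigo.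
From mathcomp Require Import ring zify.

Set Implicit Arguments.
Unset Strict Implicit.
Unset Printing Implicit Defensive.
Import Order.TTheory GRing.Theory Num.Theory.
Local Open Scope ring_scope.

(** Everything follows from one fact about root systems: every root is either
    a nonnegative or a nonpositive combination of the simple roots. It
    implies that the form [B], which is prescribed on positive roots only, satisfies
    [B (br b) (br a) = (b == a) - (b == - a)] on all roots ([VW_form_br]).
    Hence the numbers [B u (br a)] are the coordinates of [u], with [u] half
    the sum of the [B u (br a) *: br a] over all roots ([VW_form_expansion]),
    and the form is W-invariant ([VW_form_act]).

    Part (1). Let [w] act on [h] as the reflection in the root [a]. It sends
    [a] to [- a], so invariance makes the functional [x |-> B (mu x) (br a)]
    change sign under this reflection; it therefore vanishes on the mirror of
    [a], which forces
      [B (mu x) (br a) = (x, a) * B (mu a) (br a)]   ([hom_coefficient]).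
    Expanding [mu x] in its coordinates gives the formula, with
    [c a = B (mu a) (br a) / 2], and [c] is W-invariant because the form and
    [mu] are.

    Part (2). For any invariant [c] that represents [mu], the roots [a] and
    [- a] contribute equally, so [B (mu x) (br a) = 2 * c a * (x, a)]; this is
    nonzero for some [x], for instance [x = a], exactly when [c a != 0].

    Part (3). By (1) and (2) the kernel of [mu] is the orthogonal complement of
    the support, so the claim is that a set spans [h] exactly when nothing but
    0 is orthogonal to it. This holds as soon as the form on [h] is
    non-degenerate ([hform_nondegenerate]): a radical vector is fixed by all
    simple reflections, hence by W, while the sum of all elements of W,
    taking the same value on [alpha_i] and on [s_i alpha_i = - alpha_i], is 0
    on [h], so the only fixed vector is 0.

    The sign of roots ([root_nonneg_or_nonpos]) is proved by induction on word
    length: if [l (w s_i) >= l w], then [w alpha_i] is nonnegative. If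
    [l w > 0], some [s_j] shortens [w] on the right, and one peels off from [w]
    the longest possible alternating word in [s_i], [s_j] ending in [s_j] and
    such that lengths add up: [w = v * alt]. The first letter of [alt]
    does not shorten [v], because lengths add up, and the other generator does
    not, by maximality; so [v alpha_i] and [v alpha_j] are nonnegative by
    induction. The alternating word has fewer than [m i j] letters, since with
    [m i j] letters it could be rewritten to end in [s_i], against the
    hypothesis on [w]. For such a word, [alt alpha_i] is a combination of
    [alpha_i], [alpha_j] with coefficients [sin (k pi / m i j) / sin (pi / m i j)],
    [0 <= k <= m i j], which are nonnegative. *)

(** * Length of an element of a finite group over a family of generators *)

Section WordLength.
Variables (W : finGroupType) (r : nat) (s : 'I_r -> W).
Hypothesis genW : <<[set s i | i : 'I_r]>>%g = [set: W].

Lemma generated_ind (P : W -> Prop) :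
  P 1%g -> (forall w i, P w -> P (w * s i)%g) -> forall w, P w.
Proof.
move=> P1 PM w; have /gen_prodgP[n [c cS ->]] : w \in <<[set s i | i : 'I_r]>>%g.
  by rewrite genW inE.
elim: n c cS => [|n IHn] c cS; first by rewrite big_ord0.
rewrite big_ord_recr /=; have /imsetP[i _ ->] := cS ord_max.
by apply/PM/IHn => k; exact: cS.
Qed.

Definition word_of n (w : W) : bool :=
  [exists u : n.-tuple 'I_r, w == (\prod_(i <- u) s i)%g].

Lemma exists_word w : exists n, word_of n w.
Proof.
elim/generated_ind: w => [|w i [n /existsP[u /eqP->]]].
  by exists 0%N; apply/existsP; exists [tuple]; rewrite big_nil.
exists n.+1; apply/existsP; exists [tuple of rcons u i].
by rewrite big_rcons.
Qed.

Definition word_length w : nat := ex_minn (exists_word w).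

Lemma word_lengthM w i : (word_length (w * s i) <= (word_length w).+1)%N.
Proof.
rewrite /word_length; case: ex_minnP => k _; apply.
case: ex_minnP => n /existsP[u /eqP->] _.
by apply/existsP; exists [tuple of rcons u i]; rewrite big_rcons.
Qed.

Lemma word_length0 w : word_length w = 0%N -> w = 1%g.
Proof.
rewrite /word_length; case: ex_minnP => n /existsP[u /eqP->] _ n0.
by case: u => u; rewrite n0 => /= /eqP/size0nil ->; rewrite big_nil.
Qed.

Hypothesis sK : forall i, (s i * s i = 1)%g.

(** Dropping the last letter of a shortest word lowers the length by at least
    one, and since [s i] is an involution, by at most one. *)
Lemma word_length_descent w :
  (0 < word_length w)%N ->
  exists i, word_length w = (word_length (w * s i)).+1.
Proof.
move=> L0; suff [i le] : exists i, (word_length (w * s i) < word_length w)%N.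
  exists i; apply/eqP; rewrite eqn_leq le andbT.
  by have := word_lengthM (w * s i)%g i; rewrite -mulgA sK mulg1.
move: L0; rewrite /word_length; case: (ex_minnP (exists_word w)) => -[//|n].
case/existsP=> -[u]; case/lastP: u => // u i /= + /eqP wE _ _.
rewrite size_rcons eqSS => un; exists i; rewrite ltnS.
case: ex_minnP => k _; apply; apply/existsP; exists (Tuple un).
by rewrite wE big_rcons -mulgA sK mulg1.
Qed.

End WordLength.

(** * Alternating words in two involutions *)

Section AlternatingWords.
Variables (W : groupType) (r : nat) (s : 'I_r -> W).
Hypothesis sK : forall i, (s i * s i = 1)%g.

(** The last letter is kept fixed, whatever [k]: lengthening the word then means
    multiplying on the left, while the end that meets [alpha_i] stays put. *)
Fixpoint alt_word k (i j : 'I_r) : W :=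
  if k is k'.+1 then (alt_word k' j i * s j)%g else 1%g.

(** The letter that extends [alt_word k i j] on the left. *)
Definition alt_letter k (i j : 'I_r) := if odd k then i else j.

Lemma alt_letterS k i j : alt_letter k.+1 i j = alt_letter k j i.
Proof. by rewrite /alt_letter /=; case: odd. Qed.

Lemma alt_wordS k i j :
  alt_word k.+1 i j = (s (alt_letter k i j) * alt_word k i j)%g.
Proof.
elim: k i j => [|k IHk] i j; first by rewrite /= mulg1 mul1g.
by rewrite [LHS]/= -[(_ * s i)%g]/(alt_word k.+1 j i) IHk -mulgA alt_letterS.
Qed.

(** When [(s i * s j) ^+ k = 1], the right-hand side is 1 and this is the
    braid relation between the two alternating words with [k] letters. *)
Lemma alt_word_swap k i j :
  (alt_word k i j * (alt_word k j i)^-1 =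
   (s (alt_letter k j i) * s (alt_letter k i j)) ^+ k)%g.
Proof.
elim: k => [|k IHk]; first by rewrite /= invg1 mulg1.
have sV p : (s p)^-1%g = s p by rewrite -[LHS]mulg1 -(sK p) mulKg.
rewrite !alt_wordS invgM sV mulgA -(mulgA _ (alt_word k i j)) IHk !alt_letterS.
move: (s _) (s _) => d e; rewrite expgSr.
suff -> : (e * (d * e) ^+ k = (e * d) ^+ k * e)%g by rewrite -mulgA.
elim: k {IHk} => [|k IHk]; first by rewrite !expg0 mulg1 mul1g.
by rewrite expgSr mulgA IHk expgSr !mulgA.
Qed.

End AlternatingWords.

(** * The coefficients of roots of a dihedral group *)

Section ChebyshevSine.
Variables (R : realType) (n : nat).
Hypothesis n_gt1 : (1 < n)%N.
Let theta : R := pi / n%:R.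

(** The values at [cos (pi / n)] of the Chebyshev polynomials of the second
    kind, with the index shifted by one; hence the three-term recurrence. *)
Definition sine_ratio k : R := sin (k%:R * theta) / sin theta.

Let sin_theta_gt0 : 0 < sin theta.
Proof.
have n0 : 0 < n%:R :> R by rewrite ltr0n; lia.
apply: sin_gt0_pi; rewrite divr_gt0 ?pi_gt0//=.
by rewrite ltr_pdivrMr// ltr_pMr ?pi_gt0// ltr1n.
Qed.

Lemma sine_ratio0 : sine_ratio 0 = 0.
Proof. by rewrite /sine_ratio mul0r sin0 mul0r. Qed.

Lemma sine_ratio1 : sine_ratio 1 = 1.
Proof. by rewrite /sine_ratio mul1r divff// gt_eqF. Qed.

Lemma sine_ratioSS k :
  sine_ratio k.+2 = 2 * cos (pi / n%:R) * sine_ratio k.+1 - sine_ratio k.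
Proof.
rewrite /sine_ratio -/theta.
have -> : k.+2%:R * theta = k.+1%:R * theta + theta.
  by rewrite -addn1 natrD mulrDl mul1r.
have -> : k%:R * theta = k.+1%:R * theta - theta.
  by rewrite -addn1 natrD mulrDl mul1r addrK.
rewrite sinD sinB; field; exact: lt0r_neq0.
Qed.

Lemma sine_ratio_ge0 k : (k <= n)%N -> 0 <= sine_ratio k.
Proof.
move=> kn; have n0 : 0 < n%:R :> R by rewrite ltr0n; lia.
apply: divr_ge0; last exact: ltW.
apply: sin_ge0_pi; rewrite mulr_ge0 ?ler0n ?divr_ge0 ?pi_ge0//=.
rewrite /theta mulrA ler_pdivrMr// mulrC ler_wpM2l ?pi_ge0//.
by rewrite ler_nat.
Qed.

End ChebyshevSine.

(** * The bilinear form of a Coxeter matrix *)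

Section Form.
Variables (R : realType) (r : nat) (m : 'M[nat]_r).
Hypothesis m_cox : coxeter_matrix m.
Implicit Types (x y : 'cV[R[i]]_r).

Lemma hformBr x y z : hform m x (y - z) = hform m x y - hform m x z.
Proof. by rewrite /hform mulmxBr !mxE. Qed.

Lemma hformZr k x y : hform m x (k *: y) = k * hform m x y.
Proof. by rewrite /hform -scalemxAr mxE. Qed.

Lemma hformNr x y : hform m x (- y) = - hform m x y.
Proof. by rewrite /hform mulmxN mxE. Qed.

Lemma hformC x y : hform m x y = hform m y x.
Proof.
have [_ mC _] := m_cox; rewrite /hform.
have gT : (gram R m)^T = gram R m by apply/matrixP => i j; rewrite !mxE mC.
transitivity ((x^T *m gram R m *m y)^T 0 0); first by rewrite [RHS]mxE.
by rewrite !trmx_mul trmxK gT mulmxA.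
Qed.

Lemma hformBl x y z : hform m (y - z) x = hform m y x - hform m z x.
Proof. by rewrite !(hformC _ x) hformBr. Qed.

Lemma hformZl k x y : hform m (k *: y) x = k * hform m y x.
Proof. by rewrite !(hformC _ x) hformZr. Qed.

Lemma hform_simple i j :
  hform m (simple_root R i) (simple_root R j) = (- cos (pi / (m i j)%:R))%:C%C.
Proof.
rewrite /hform trmx_delta -rowE mxE (bigD1 j)//= !mxE !eqxx mulr1.
by rewrite big1 ?addr0// => k kj; rewrite !mxE (negPf kj) mulr0.
Qed.

Lemma hform_simple_id i : hform m (simple_root R i) (simple_root R i) = 1.
Proof.
have [m1 _ _] := m_cox.
by rewrite hform_simple m1 divr1 cospi opprK.
Qed.

End Form.

(** * Roots and reflections *)

Section ReflectionRepresentation.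
Variables (R : realType) (r : nat) (m : 'M[nat]_r).
Variables (W : finGroupType) (s : 'I_r -> W).
Variable (rho : mx_representation R[i] [set: W] r).
Hypothesis m_cox : coxeter_matrix m.
Hypothesis genW : <<[set s i | i : 'I_r]>>%g = [set: W].
Hypothesis relW : forall i j, ((s i * s j) ^+ m i j = 1)%g.
Hypothesis rhoP : reflection_representation m s rho.
Implicit Types (x y a b : 'cV[R[i]]_r).

Lemma generator_invol i : (s i * s i = 1)%g.
Proof. by have [m1 _ _] := m_cox; rewrite -(relW i i) m1 expg1. Qed.

Lemma rhoM v w x : rho (v * w)%g *m x = rho v *m (rho w *m x).
Proof. by rewrite repr_mxM ?inE// mulmxA. Qed.

Lemma rho1 x : rho 1%g *m x = x.
Proof. by rewrite repr_mx1 mul1mx. Qed.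

Lemma hform_rho w x y : hform m (rho w *m x) (rho w *m y) = hform m x y.
Proof.
elim/(generated_ind genW): w x y => [|w i IHw] x y; first by rewrite !rho1.
rewrite !rhoM IHw !rhoP /simple_reflection.
rewrite !(hformBr, hformZr, hformBl m_cox, hformZl m_cox) hform_simple_id//.
by rewrite (hformC m_cox (simple_root R i) y); ring.
Qed.

Lemma root_norm a : a \in root_system rho -> hform m a a = 1.
Proof. by case/mem_root_system=> w [i ->]; rewrite hform_rho hform_simple_id. Qed.

(** For [a = v alpha_i], the conjugate [v * s i * v^-1] is the reflection in
    [a], because [v] is orthogonal for the form. *)
Lemma root_reflection a : a \in root_system rho ->
  exists w, forall x, rho w *m x = x - (2 * hform m x a) *: a.
Proof.
case/mem_root_system=> v [i ->]; exists (v * s i * v^-1)%g => x.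
have -> : x = rho v *m (rho v^-1%g *m x) by rewrite -rhoM mulgV rho1.
rewrite 2!rhoM -(rhoM v^-1 v) mulVg rho1 rhoP /simple_reflection hform_rho.
by rewrite mulmxBr -scalemxAr.
Qed.

Lemma root_negation a : a \in root_system rho -> exists w, rho w *m a = - a.
Proof.
move=> aR; have [w wE] := root_reflection aR; exists w.
by rewrite wE root_norm// mulr1 scalerDl scale1r opprD addNKr.
Qed.

Lemma rootN a : a \in root_system rho -> - a \in root_system rho.
Proof. by move=> aR; have [w <-] := root_negation aR; rewrite rho_root_system. Qed.

Lemma root_neq_opp a : a \in root_system rho -> (a == - a) = false.
Proof.
move=> aR; apply/negP => /eqP aN; have := root_norm aR.
have -> : a = 0.
  apply/matrixP => i j; move/matrixP/(_ i j): aN; rewrite !mxE => /eqP.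
  by rewrite -addr_eq0 -mulr2n mulrn_eq0 => /eqP.
by rewrite -(scale0r 0) hformZr mul0r => /eqP; rewrite eq_sym oner_eq0.
Qed.

(** * Every root is nonnegative or nonpositive *)

Definition nonneg_vector x := forall i, 0 <= x i 0.

Lemma nonneg_simple i : nonneg_vector (simple_root R i).
Proof. by move=> j; rewrite mxE ler0n. Qed.

Lemma nonneg_vector_comb (p q : R) x y :
  0 <= p -> 0 <= q -> nonneg_vector x -> nonneg_vector y ->
  nonneg_vector (p%:C%C *: x + q%:C%C *: y).
Proof.
by move=> p0 q0 x0 y0 i; rewrite !mxE addr_ge0// mulr_ge0 ?x0 ?y0// ler0c.
Qed.

(** One simple reflection applied to a combination of the two simple roots
    [x] and [y] with [(x, y) = - c]: the coefficients follow the recurrence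
    [sine_ratioSS]. *)
Lemma chebyshev_step (c p q : R) x y :
  p%:C%C *: (x - (2 * (- c)%:C%C) *: y) + q%:C%C *: (y - (2 * 1) *: y) =
  (2 * c * p - q)%:C%C *: y + p%:C%C *: x.
Proof.
rewrite rmorphB rmorphN /= !rmorphM /= rmorph_nat.
move: (p%:C%C) (q%:C%C) (c%:C%C) => p' q' c'.
by apply/matrixP => a b; rewrite !mxE; ring.
Qed.

(** In the Euclidean plane of the two simple roots, with [theta = pi / m i j],
    the right-hand side is the unit vector at angle [k * theta] from the simple
    root of [alt_letter k j i], on the side of the other one. The two simple
    roots are [pi - theta] apart, so the reflection in the latter turns this
    into the angle [(k + 1) * theta] from that latter root. *)
Lemma alt_word_simple k i j : i != j ->
  rho (alt_word s k i j) *m simple_root R i =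
  (sine_ratio R (m i j) k.+1)%:C%C *: simple_root R (alt_letter k j i)
  + (sine_ratio R (m i j) k)%:C%C *: simple_root R (alt_letter k i j).
Proof.
move=> ij; have [_ mC /(_ _ _ ij) m2] := m_cox.
elim: k => [|k IHk].
  by rewrite /= rho1 sine_ratio1// sine_ratio0 scale1r scale0r addr0.
rewrite alt_wordS rhoM.
rewrite IHk !alt_letterS mulmxDr -!scalemxAr !rhoP /simple_reflection.
have med : m (alt_letter k j i) (alt_letter k i j) = m i j.
  by rewrite /alt_letter; case: odd.
move: (alt_letter k i j) (alt_letter k j i) med => d e med.
rewrite (sine_ratioSS R m2).
have := hform_simple_id R m_cox d; have := hform_simple R m e d; rewrite med.
move: (simple_root R d) (simple_root R e) => x y -> ->; exact: chebyshev_step.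
Qed.

Let L := word_length genW.

(** Strong induction on the length of [w]; inside it, the alternating word
    that is split off from [w] is lengthened one letter at a time until the
    remaining factor [v] is shortened by neither of the two generators. The
    inner induction is on [d = m i j - k], the number of letters left. *)
Lemma nonneg_of_ascent w i :
  (L w <= L (w * s i))%N -> nonneg_vector (rho w *m simple_root R i).
Proof.
have sK := generator_invol.
have Ls v p : (L (v * s p) <= (L v).+1)%N := word_lengthM genW v p.
have Lalt v k p q : (L (v * alt_word s k p q) <= L v + k)%N.
  elim: k p q v => [|k IHk] p q v; first by rewrite mulg1 addn0.
  by rewrite /= mulgA addnS; apply: leq_trans (Ls _ _) _; rewrite ltnS.
have [n] := ubnP (L w); elim: n w i => // n IHn w i Lwn asc.
have [L0|Lpos] := posnP (L w).
  by rewrite (word_length0 L0) rho1; exact: nonneg_simple.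
have [j Lj] := word_length_descent sK Lpos.
have ij : i != j.
  by apply: contraTneq asc => ->; rewrite -ltnNge /L Lj.
have [_ mC /(_ _ _ ij) m2] := m_cox.
(* Start of the peeling: [w = (w s_j) * s_j], a word with one letter. *)
suff main d : forall k v, (k + d = m i j)%N -> (0 < k)%N ->
    w = (v * alt_word s k i j)%g -> L w = (L v + k)%N ->
    nonneg_vector (rho w *m simple_root R i).
  apply: (main (m i j).-1 1%N (w * s j)%g) => //; first lia.
    by rewrite /= mul1g -mulgA sK mulg1.
  by rewrite addn1.
elim: d => [|d IHd] k v kd k0 wE Lw.
  (* A full half-turn of the dihedral group also ends in [s_i], so [s_i]
     shortens [w]: contradiction with [asc]. *)
  have swap : alt_word s (m i j) i j = alt_word s (m i j) j i.
    apply/eqP; rewrite eq_mulgV1 alt_word_swap//; apply/eqP.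
    by rewrite /alt_letter; case: odd; rewrite ?relW// mC relW.
  have kE : (k.-1.+1 = m i j)%N by lia.
  move: asc; have -> : (w * s i = v * alt_word s k.-1 i j)%g.
    rewrite wE -(addn0 k) kd swap -kE /= -!mulgA sK mulg1 //.
  by have := Lalt v k.-1 i j; lia.
(* The first letter of the word cannot shorten [v], otherwise [w] would be
   shorter than [L v + k]. *)
have Le : (L v <= L (v * s (alt_letter k.-1 i j)))%N.
  have := Lalt (v * s (alt_letter k.-1 i j))%g k.-1 i j.
  by rewrite -mulgA -alt_wordS// prednK// -wE; lia.
(* If the other generator shortens [v], it is moved into the word. *)
have [Lq|Lq] := leqP (L v) (L (v * s (alt_letter k i j))); last first.
  have vE : w = (v * s (alt_letter k i j) * alt_word s k.+1 i j)%g.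
    by rewrite alt_wordS// -!mulgA (mulgA (s _)) sK mul1g.
  apply: (IHd k.+1 _ _ _ vE) => //; first lia.
  have := Lalt (v * s (alt_letter k i j))%g k.+1 i j; rewrite -vE; lia.
have Lvn : (L v < n)%N by lia.
rewrite wE rhoM alt_word_simple// mulmxDr -!scalemxAr.
apply: nonneg_vector_comb; [apply: sine_ratio_ge0 => //; lia.. | |].
  by apply: IHn => //; rewrite -{1}(prednK k0) alt_letterS.
exact: IHn.
Qed.

(** Either [w] or [w * s i] ascends along [s i], and the two send [alpha_i] to
    opposite roots. *)
Lemma root_nonneg_or_nonpos a : a \in root_system rho ->
  nonneg_vector a \/ nonneg_vector (- a).
Proof.
case/mem_root_system=> w [i ->].
have [le|lt] := leqP (L w) (L (w * s i)); first by left; exact: nonneg_of_ascent.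
right; have : nonneg_vector (rho (w * s i)%g *m simple_root R i).
  by apply: nonneg_of_ascent; rewrite -mulgA generator_invol mulg1 ltnW.
rewrite rhoM rhoP /simple_reflection hform_simple_id// mulr1.
by rewrite scalerDl scale1r opprD addNKr mulmxN.
Qed.

(** * Non-degeneracy of the form *)

(** A radical vector [x] is fixed by W, so the sum [e] of the group elements
    multiplies it by the order of W. But [e alpha_i = e (s_i alpha_i) =
    - e alpha_i], so [e] is 0. *)
Lemma hform_nondegenerate x : (forall y, hform m x y = 0) -> x = 0.
Proof.
move=> x0; have fix_x w : rho w *m x = x.
  elim/(generated_ind genW): w => [|w i IHw]; first exact: rho1.
  by rewrite rhoM rhoP /simple_reflection x0 mulr0 scale0r subr0.
pose e : 'M[R[i]]_r := \sum_w rho w.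
have eM v : e *m rho v = e.
  rewrite /e mulmx_suml (reindex_inj (mulIg v^-1%g)); apply: eq_bigr => w _ /=.
  by rewrite -repr_mxM ?inE// mulgKV.
have e0 : e = 0.
  suff e_simple i : e *m simple_root R i = 0.
    apply/matrixP => k i; have /matrixP/(_ k 0) := e_simple i.
    by rewrite -colE !mxE.
  have : e *m (rho (s i) *m simple_root R i) = - (e *m simple_root R i).
    rewrite rhoP /simple_reflection hform_simple_id// mulr1 scalerDl scale1r.
    by rewrite opprD addNKr mulmxN.
  rewrite mulmxA eM => /eqP; rewrite -addr_eq0 -mulr2n -scaler_nat scaler_eq0.
  by rewrite pnatr_eq0 => /eqP.
have /eqP : e *m x = #|W|%:R *: x.
  rewrite /e mulmx_suml (eq_bigr (fun=> x)) => [|w _]; last exact: fix_x.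
  by rewrite sumr_const scaler_nat.
rewrite e0 mul0mx eq_sym scaler_eq0 pnatr_eq0 => /orP[/eqP W0|/eqP//].
by have := cardG_gt0 [set: W]; rewrite cardsT W0.
Qed.

Lemma gram_unit : gram R m \in unitmx.
Proof.
rewrite -row_free_unit -kermx_eq0; apply/eqP/row_matrixP => i; rewrite row0.
apply: trmx_inj; rewrite trmx0; apply: hform_nondegenerate => y.
by rewrite /hform trmxK -row_mul mulmx_ker row0 mul0mx mxE.
Qed.

(** If the span [U] of [S] is proper, a nonzero row of the matrix of the
    projection onto a complement of [U] is a functional vanishing on [U]; by
    non-degeneracy it is pairing with some vector, orthogonal to [S]. *)
Lemma spans_iff_orthogonal_trivial (S : seq 'cV[R[i]]_r) :
  (forall x, (forall a, a \in S -> hform m x a = 0) -> x = 0) <->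
  <<S>>%VS = fullv.
Proof.
split=> [orth0|S_full x x0]; last first.
  pose h := linfun (mulmx (x^T *m gram R m) : 'cV[R[i]]_r -> 'M[R[i]]_1).
  have Sh : (<<S>> <= lker h)%VS.
    apply/span_subvP => a aS; rewrite memv_ker lfunE /=.
    by apply/eqP/matrixP => i j; rewrite !ord1 [LHS]x0// mxE.
  apply: hform_nondegenerate => y.
  have : y \in lker h by rewrite (subvP Sh)// S_full memvf.
  by rewrite memv_ker lfunE /= /hform => /eqP ->; rewrite mxE.
set U := <<S>>%VS.
pose P := lin1_mx (trmx \o ((\1 - projv U)%VF \o trmx) : 'rV[R[i]]_r -> 'rV_r).
have PE (v : 'cV_r) : v - projv U v = P^T *m v.
  apply: trmx_inj; rewrite trmx_mul trmxK mul_rV_lin1 /= trmxK.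
  by rewrite add_lfunE opp_lfunE id_lfunE.
suff P0 : P^T = 0.
  apply/vspaceP => v; rewrite memvf.
  by have := memv_proj U v; have /eqP := PE v; rewrite P0 mul0mx subr_eq0 => /eqP <-.
apply/row_matrixP => k; rewrite row0.
suff : invmx (gram R m) *m (row k P^T)^T = 0.
  move/(congr1 (mulmx (gram R m))); rewrite mulmx0 mulKVmx ?gram_unit//.
  by move/(congr1 trmx); rewrite trmxK trmx0.
apply: orth0 => a aS; rewrite hformC// /hform -mulmxA mulKVmx ?gram_unit//.
have : P^T *m a = 0 by rewrite -PE projv_id ?subrr// memv_span.
move=> /(congr1 (row k)); rewrite row_mul row0 => /(congr1 trmx).
by rewrite trmx_mul trmx0 => ->; rewrite mxE.
Qed.

(** * The coordinate form on the space of roots *)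

Lemma nonneg_root_opp a :
  a \in root_system rho -> nonneg_vector a -> ~ nonneg_vector (- a).
Proof.
move=> aR a0 Na0; move/negP: (root_neq_opp aR); apply; apply/eqP.
apply/matrixP => i j; rewrite (ord1 j).
have ai0 : a i 0 = 0.
  apply: le_anti; rewrite a0 andbT -oppr_ge0.
  by have := Na0 i; rewrite mxE.
by rewrite mxE ai0 oppr0.
Qed.

Lemma big_root_eq_opp (V : lmodType R[i]) (F : 'cV[R[i]]_r -> V) b :
  b \in root_system rho ->
  \sum_(a <- root_system rho) ((b == a)%:R - (b == - a)%:R) *: F a = F b - F (- b).
Proof.
move=> bR; under eq_bigr do rewrite scalerBl.
rewrite big_split sumrN /= (bigD1_seq b) ?undup_uniq//= eqxx scale1r.
rewrite big1 ?addr0; last by move=> a ab; rewrite eq_sym (negPf ab) scale0r.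
congr (_ - _); rewrite (bigD1_seq (- b)) ?rootN ?undup_uniq//= opprK eqxx scale1r.
rewrite big1 ?addr0// => a ab; rewrite -eqr_oppLR eq_sym (negPf ab).
by rewrite scale0r.
Qed.

Lemma br_spans (u : VW rho) :
  exists f : seq_sub (root_system rho) -> R[i], u = \sum_b f b *: br rho (val b).
Proof.
exists (quotv_repr u); rewrite -{1}[u]quotv_reprK.
set f := quotv_repr u.
have {1}-> : f = \sum_b f b *: root_symb rho (val b).
  apply/ffunP => c; rewrite sum_ffunE (bigD1 c)//= !ffunE eqxx.
  rewrite big1 ?addr0 => [|b bc]; first by rewrite /GRing.scale /= mulr1.
  by rewrite !ffunE (inj_eq val_inj) eq_sym (negPf bc) scaler0.
by rewrite linear_sum; apply: eq_bigr => b _; rewrite linearZ.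
Qed.

Section InvariantForm.
Variable B : {biscalar (VW rho)}.
Hypothesis BP : VW_form B.

Lemma positive_rootE a :
  a \in root_system rho -> nonneg_vector a -> a \in positive_roots rho.
Proof. by move=> aR a0; rewrite mem_filter aR andbT; apply/forallP. Qed.

(** Both sides change sign when [a] or [b] is replaced by its opposite, so the
    general case reduces to two positive roots; these are never opposite. *)
Lemma VW_form_br a b :
  a \in root_system rho -> b \in root_system rho ->
  B (br rho a) (br rho b) = (a == b)%:R - (a == - b)%:R.
Proof.
have pos x y : x \in root_system rho -> y \in root_system rho ->
    nonneg_vector x -> nonneg_vector y ->
    B (br rho x) (br rho y) = (x == y)%:R - (x == - y)%:R.
  move=> xR yR x0 y0; rewrite BP ?positive_rootE//.
  have -> : (x == - y) = false; last by rewrite subr0.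
  by apply/negP => /eqP xy; apply: (nonneg_root_opp yR y0); rewrite -xy.
have half x y : x \in root_system rho -> y \in root_system rho ->
    nonneg_vector x -> B (br rho x) (br rho y) = (x == y)%:R - (x == - y)%:R.
  move=> xR yR x0; have [y0|y0] := root_nonneg_or_nonpos yR; first exact: pos.
  have := pos x (- y) xR (rootN yR) x0 y0.
  by rewrite br_opp// linearNr opprK => /(canRL (@opprK _)) ->; rewrite opprB.
move=> aR bR; have [a0|a0] := root_nonneg_or_nonpos aR; first exact: half.
have := half (- a) b (rootN aR) bR a0.
rewrite br_opp// linearNl eqr_oppLR eqr_opp => /(canRL (@opprK _)) ->.
by rewrite opprB.
Qed.

(** The factor 1/2 is there because [br a] and [br (- a)] represent the same
    line, so that the sum over all roots counts each coordinate twice. *)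
Lemma VW_form_expansion u :
  u = 2^-1 *: \sum_(a <- root_system rho) B u (br rho a) *: br rho a.
Proof.
have two0 : 2 != 0 :> R[i] by rewrite pnatr_eq0.
have [f ->] := br_spans u.
under [in RHS]eq_bigr do rewrite linear_sumlz scaler_suml.
rewrite exchange_big scaler_sumr; apply: eq_bigr => b _ /=.
have bR := valP b.
under eq_bigr do rewrite linearZl_LR /= -scalerA.
rewrite -scaler_sumr scalerA mulrC -scalerA; congr (_ *: _).
under eq_big_seq => a aR do rewrite VW_form_br//.
rewrite big_root_eq_opp// br_opp// opprK -mulr2n -(scaler_nat 2 (br _ _)) scalerA.
by rewrite mulVf// scale1r.
Qed.

Lemma VW_form_act w u a : a \in root_system rho ->
  B (VW_act w u) (br rho (rho w *m a)) = B u (br rho a).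
Proof.
move=> aR; have [f ->] := br_spans u; rewrite linear_sum !linear_sumlz.
apply: eq_bigr => b _ /=; rewrite linearZ !linearZl_LR /=; congr (_ * _).
have wI : injective (mulmx (rho w) : 'cV[R[i]]_r -> _).
  by apply: (can_inj (g := mulmx (rho w^-1%g))) => x; rewrite -rhoM mulVg rho1.
rewrite VW_act_br !VW_form_br ?rho_root_system ?(valP b)//.
by rewrite -mulmxN !(inj_eq wI).
Qed.

(** * Equivariant maps from the reflection representation *)

Section Homomorphism.
Variable mu : {linear 'cV[R[i]]_r -> VW rho}.
Hypothesis muP : W_hom mu.

(** Apply invariance of the form under the reflection in [a]: replacing [x] by
    [x - 2 (x, a) a] and [a] by [- a] does not change [B (mu x) (br a)], so
    [- B (mu x) (br a) + 2 (x, a) B (mu a) (br a) = B (mu x) (br a)]. *)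
Lemma hom_coefficient x a : a \in root_system rho ->
  B (mu x) (br rho a) = hform m x a * B (mu a) (br rho a).
Proof.
move=> aR; have [w wE] := root_reflection aR.
have := VW_form_act w (mu x) aR; rewrite -muP !wE root_norm// mulr1.
rewrite scalerDl scale1r opprD addNKr br_opp// linearNr linearB linearZ /=.
rewrite linearBl linearZl_LR /= => e.
have two0 : 2 != 0 :> R[i] by rewrite pnatr_eq0.
apply: (mulfI two0); rewrite [LHS]mulr_natl mulr2n -{1}e; ring.
Qed.

Definition root_coefficient a : R[i] := 2^-1 * B (mu a) (br rho a).

Lemma root_coefficient_invariant : W_invariant rho root_coefficient.
Proof. by move=> w a aR; rewrite /root_coefficient muP VW_form_act. Qed.

Lemma hom_expansion x :
  mu x = \sum_(a <- root_system rho)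
           (root_coefficient a * hform m x a) *: br rho a.
Proof.
rewrite [LHS]VW_form_expansion scaler_sumr; apply: eq_big_seq => a aR.
rewrite hom_coefficient// scalerA /root_coefficient; congr (_ *: _).
by rewrite -mulrA; congr (_ * _); rewrite mulrC.
Qed.

(** The factor 2 collects the equal contributions of [a] and [- a], which the
    reflection in [a] exchanges. *)
Lemma coefficient_of_expansion c :
  W_invariant rho c ->
  (forall x, mu x = \sum_(a <- root_system rho) (c a * hform m x a) *: br rho a) ->
  forall x a, a \in root_system rho ->
    B (mu x) (br rho a) = 2 * c a * hform m x a.
Proof.
move=> cW muE x a aR; rewrite muE linear_sumlz.
have cN : c (- a) = c a by have [w <-] := root_negation aR; exact: cW.
transitivity (\sum_(b <- root_system rho) ((a == b)%:R - (a == - b)%:R)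
                *: (c b * hform m x b : R[i]^o)).
  apply: eq_big_seq => b bR; rewrite linearZl_LR /= VW_form_br// mulrC.
  by rewrite (eq_sym a b) (eq_sym a) eqr_oppLR.
by rewrite big_root_eq_opp// cN hformNr; ring.
Qed.

Lemma mem_supp_expansion c :
  W_invariant rho c ->
  (forall x, mu x = \sum_(a <- root_system rho) (c a * hform m x a) *: br rho a) ->
  forall a, (a \in supp B (range mu)) = (a \in root_system rho) && (c a != 0).
Proof.
move=> cW muE a; rewrite mem_filter andbC; have [aR|//] := boolP (a \in _).
have coef := coefficient_of_expansion cW muE.
apply/asboolP/idP => [[_ [x _ <-]]|c0].
  by rewrite coef// -mulrA mulrCA mulf_eq0 negb_or => /andP[].
exists (mu a); first by exists a.
by rewrite coef// root_norm// mulr1 mulf_neq0 ?pnatr_eq0.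
Qed.

Lemma hom_eq0 x :
  mu x = 0 <-> (forall a, a \in supp B (range mu) -> hform m x a = 0).
Proof.
have memE := mem_supp_expansion root_coefficient_invariant hom_expansion.
split=> [mux0 a|x0].
  rewrite memE => /andP[aR c0]; have := hom_coefficient x aR.
  rewrite mux0 linear0l => /esym/eqP; rewrite mulf_eq0 => /orP[/eqP//|/eqP B0].
  by rewrite /root_coefficient B0 mulr0 eqxx in c0.
rewrite hom_expansion big_seq big1// => a aR.
have [->|c0] := eqVneq (root_coefficient a) 0; first by rewrite mul0r scale0r.
by rewrite x0 ?mulr0 ?scale0r// memE aR.
Qed.

Lemma hom_injective_supp :
  injective mu <-> <<supp B (range mu)>>%VS = fullv.
Proof.
rewrite -spans_iff_orthogonal_trivial; split=> [mu_inj x /hom_eq0 x0|orth0].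
  by apply: mu_inj; rewrite x0 linear0.
by apply: raddf_inj => x /hom_eq0; exact: orth0.
Qed.

End Homomorphism.
End InvariantForm.
End ReflectionRepresentation.

(** * The theorem *)

Theorem lemma6p5 (R : realType) (r : nat) (m : 'M[nat]_r)
    (W : finGroupType) (s : 'I_r -> W)
    (rho : mx_representation R[i] [set: W] r)
    (B : {biscalar (VW rho)})
    (mu : {linear 'cV[R[i]]_r -> VW rho}) :
  coxeter_matrix m ->
  coxeter_presentation m s ->
  reflection_representation m s rho ->
  VW_form B ->
  W_hom mu ->
  [/\ exists c : 'cV[R[i]]_r -> R[i],
        W_invariant rho c /\
        (forall x, mu x = \sum_(a <- root_system rho) (c a * hform m x a) *: br rho a),
      forall c : 'cV[R[i]]_r -> R[i],
        W_invariant rho c ->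
        (forall x, mu x = \sum_(a <- root_system rho) (c a * hform m x a) *: br rho a) ->
        forall a, (a \in supp B (range mu)) = (a \in root_system rho) && (c a != 0)
    & injective mu <-> <<supp B (range mu)>>%VS = fullv].
Proof.
move=> m_cox [genW relW _] rhoP BP muP; split.
- exists (root_coefficient B mu); split.
    exact: (root_coefficient_invariant m_cox genW relW rhoP BP muP).
  exact: (hom_expansion m_cox genW relW rhoP BP muP).
- exact: (mem_supp_expansion m_cox genW relW rhoP BP).
- exact: (hom_injective_supp m_cox genW relW rhoP BP muP).
Qed.
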